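(* Let $X=X(\mathbb{T}^d,\mu)$ be a Banach lattice and let $\varepsilon>0$. Assume that there is a constant $B>0$ such that $$\left\|\frac{\partial}{\partial x_i}T_n\right\|_X\le Bn\|T_n\|_X,\qquad i=1,\dots,d,\quad T_n\in\mathcal{T}_n^d.$$ Then, for all $T_n\in\mathcal{T}_n^d$ and $N\ge\left(\frac{2\pi dB}{\log2}+\varepsilon\right)n$, $$\|T_n\|_X\asymp\bigg\|\sum_{k_1=1}^N\cdots\sum_{k_d=1}^N|T_n(x_k)|\chi_{\Omega_k}\bigg\|_X,$$ where $x_k$ is an arbitrary point in $\Omega_k=\left[\frac{2\pi(k_1-1)}N,\frac{2\pi k_1}N\right]\times\dots\times\left[\frac{2\pi(k_d-1)}N,\frac{2\pi k_d}N\right]$, $k=(k_1,\dots,k_d)\in[1,N]^d$.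
   Context: $\mathbb{T}^d=[0,2\pi)^d$ with a positive $\sigma$-finite measure $\mu$. A Banach (function) lattice $X=X(\mathbb{T}^d,\mu)$ is a Banach space of functions on $\mathbb{T}^d$ with a functional $\|\cdot\|_X$ such that: 1) $\|f\|_X=0$ iff $f=0$; 2) $\|\lambda f\|_X=|\lambda|\|f\|_X$ for $\lambda\in\mathbb{C}$; 3) $\|f+g\|_X\le\|f\|_X+\|g\|_X$; 4) if $|f|\le|g|$ then $\|f\|_X\le\|g\|_X$ for $f,g\in X$; 5) $\chi_B\in X$ for all $B$ with $\mu(B)<\infty$; moreover $X\subset L_1$ is assumed. $\mathcal{T}_n^d$ is the set of trigonometric polynomials $T(x)=\sum_{k_1=-n}^n\cdots\sum_{k_d=-n}^nc_ke^{i(k,x)}$ of degree at most $n$ in each variable. $A\asymp B$ means two-sided inequalities with positive constants independent of the essential variables (here $n$, $N$, $T_n$, and the points $x_k$). *)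

(* Defs.v *)
(* MathComp / MathComp-Analysis *)
From HB Require Import structures.
From mathcomp Require Import all_boot all_order all_algebra.
From mathcomp Require Import all_classical all_reals all_analysis.
From mathcomp Require Import complex.

Set Implicit Arguments.
Unset Strict Implicit.
Unset Printing Implicit Defensive.

Import Order.TTheory GRing.Theory Num.Theory.
Import numFieldNormedType.Exports.

Local Open Scope classical_set_scope.
Local Open Scope complex_scope.
Local Open Scope ring_scope.

(* The modulus as an element of R; on R[i] the library norm `|z| is valued
   in R[i]. *)
Notation cabs := ComplexField.Normc.normc.

(* R^d with its Borel sigma-algebra. *)
Definition borelRd (R : realType) (d : nat) :=
  g_sigma_algebraType (@open 'rV[R]_d).

Definition torus (R : realType) (d : nat) : set (borelRd R d) :=
  [set x : 'rV[R]_d | forall j, 0 <= x ord0 j < 2 * pi].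

Definition cmeasurable (R : realType) (d : nat) (f : borelRd R d -> R[i]) :=
  measurable_fun setT (fun x => complex.Re (f x)) /\
  measurable_fun setT (fun x => complex.Im (f x)).

(* A measure mu on the torus is a measure on R^d with mu (~` torus R d) = 0, and
   functions on the torus are complex Borel functions on R^d, which matter only
   up to mu-a.e. equality; f = g and |f| <= |g| are therefore read mu-a.e. *)
Record banach_lattice (R : realType) (d : nat)
    (mu : {measure set (borelRd R d) -> \bar R}) := BanachLattice {
  carrier : set (borelRd R d -> R[i]);
  latnorm : (borelRd R d -> R[i]) -> R; (* meaningful on the carrier only *)
  (* a linear space of classes of integrable functions, X \subset L_1 *)
  carrier_measurable : forall f, carrier f -> cmeasurable f;
  carrier_ae : forall f g, carrier f -> cmeasurable g ->
    {ae mu, forall x, f x = g x} -> carrier g;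
  carrier_integrable : forall f, carrier f ->
    mu.-integrable setT (fun x => (cabs (f x))%:E);
  carrier0 : carrier (fun=> 0);
  carrierD : forall f g, carrier f -> carrier g ->
    carrier (fun x => f x + g x);
  carrierZ : forall (l : R[i]) f, carrier f -> carrier (fun x => l * f x);
  latnorm_eq0 : forall f, carrier f ->
    latnorm f = 0 <-> {ae mu, forall x, f x = 0};
  latnormZ : forall (l : R[i]) f, carrier f ->
    latnorm (fun x => l * f x) = cabs l * latnorm f;
  latnormD : forall f g, carrier f -> carrier g ->
    latnorm (fun x => f x + g x) <= latnorm f + latnorm g;
  latnorm_le : forall f g, carrier f -> carrier g ->
    {ae mu, forall x, cabs (f x) <= cabs (g x)} -> latnorm f <= latnorm g;
  carrier_indic : forall A : set (borelRd R d), measurable A ->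
    (mu A < +oo)%E -> carrier (fun x => (\1_A x)%:C);
  latnorm_complete : forall u : nat -> borelRd R d -> R[i],
    (forall m, carrier (u m)) ->
    (forall e : R, 0 < e -> exists M, forall p q, (M <= p)%N -> (M <= q)%N ->
      latnorm (fun x => u p x - u q x) < e) ->
    exists2 f, carrier f &
      (fun m => latnorm (fun x => u m x - f x)) @ \oo --> (0 : R)
}.

(* The index a : 'I_d -> {0, ..., 2n} stands for the frequency vector
   k = (a_j - n)_j in {-n, ..., n}^d. *)
Definition freq_phase (R : realType) (d n : nat)
    (a : {ffun 'I_d -> 'I_n.*2.+1}) (x : 'rV[R]_d) : R :=
  \sum_(j < d) ((a j)%:R - n%:R) * x ord0 j.

Definition trigpoly (R : realType) (d n : nat) (T : 'rV[R]_d -> R[i]) : Prop :=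
  exists c : {ffun 'I_d -> 'I_n.*2.+1} -> R[i], forall x,
    T x = \sum_a c a * (cos (freq_phase a x) +i* sin (freq_phase a x)).

Definition partial (R : realType) (d : nat) (i : 'I_d) (f : 'rV[R]_d -> R[i]) :
    'rV[R]_d -> R[i] :=
  fun x => 'D_(delta_mx ord0 i) (fun y => complex.Re (f y)) x +i*
           'D_(delta_mx ord0 i) (fun y => complex.Im (f y)) x.

(* k_j ranges over {0, ..., N-1} instead of {1, ..., N}. *)
Definition cube (R : realType) (d N : nat) (k : {ffun 'I_d -> 'I_N}) :
    set (borelRd R d) :=
  [set x : 'rV[R]_d | forall j,
    2 * pi * (k j)%:R / N%:R <= x ord0 j <= 2 * pi * (k j).+1%:R / N%:R].

Definition sampled (R : realType) (d N : nat) (T : 'rV[R]_d -> R[i])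
    (p : {ffun 'I_d -> 'I_N} -> 'rV[R]_d) : borelRd R d -> R[i] :=
  fun x => \sum_k (cabs (T (p k)) * \1_(cube k) x)%:C.

(* Main.v *)
(** Let [h = 2 pi / N].  On a cube the values of [T] at [x] and at the sample
    point differ by at most the Taylor remainder
    [\sum_(m >= 1) h ^ m / m! \sum_(|w| = m) |D_w T x|], [w] ranging over the
    words in the [d] partial derivatives.  By the Bernstein inequality its norm
    is at most [(exp (h d B n) - 1) |T|_X], and the hypothesis on [N] keeps the
    factor below one, uniformly in [n]; both inequalities follow, as almost
    every point lies in at least one and at most [2 ^ d] cubes.
    Two points need care.  The sampled function lies in [X] only because [mu]
    is finite as soon as [X] contains some [T <> 0]: every [D_w T] is then
    integrable, and Taylor's formula bounds a positive constant by a
    combination of their moduli.  And [X] need not contain [|D_w T|], so moduli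
    are replaced by simple functions slightly above them. *)

Require Import Defs.
From HB Require Import structures.
From mathcomp Require Import all_boot all_order all_algebra.
From mathcomp Require Import all_classical all_reals all_analysis.
From mathcomp Require Import complex ring lra.

Set Implicit Arguments.
Unset Strict Implicit.
Unset Printing Implicit Defensive.

Import Order.TTheory GRing.Theory Num.Theory.
Import numFieldNormedType.Exports.

Local Open Scope classical_set_scope.
Local Open Scope ring_scope.

(** * Taylor expansion of the complex exponential *)

Section TrigonometricTaylor.
Variable R : realType.
Implicit Types (t K : R) (z : R[i]).

Lemma le_cabsD z1 z2 : cabs (z1 + z2) <= cabs z1 + cabs z2.
Proof. exact: complex.le_normcD. Qed.

Lemma cabs_ge0 z : 0 <= cabs z.
Proof. by case: z => a b; exact: sqrtr_ge0. Qed.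

Lemma cabsN z : cabs (- z) = cabs z.
Proof. exact: complex.normcN. Qed.

Lemma cabs_real t : cabs t%:C%C = `|t|.
Proof. by rewrite /= expr0n addr0 sqrtr_sqr. Qed.

Lemma le_cabs_ReIm z : cabs z <= `|complex.Re z| + `|complex.Im z|.
Proof.
case: z => a b; rewrite /= -(ler_pXn2r (n := 2)) ?nnegrE ?sqrtr_ge0 ?addr_ge0 //.
rewrite sqr_sqrtr ?addr_ge0 ?sqr_ge0 // sqrrD !real_normK ?num_real //.
by rewrite lerD2r lerDl mulrn_wge0 // mulr_ge0.
Qed.

Lemma le_cabs_sum (I : Type) (r : seq I) (P : pred I) (F : I -> R[i]) :
  cabs (\sum_(i <- r | P i) F i) <= \sum_(i <- r | P i) cabs (F i).
Proof.
elim/big_rec2: _ => [|i x y _ le_yx]; first by rewrite cabs_real normr0.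
by rewrite (le_trans (le_cabsD _ _)) // lerD2l.
Qed.

Definition cis t : R[i] := (cos t +i* sin t)%C.

Lemma cisD s t : cis (s + t) = cis s * cis t.
Proof.
by apply/eqP; rewrite eq_complex /= cosD sinD; apply/andP; split; apply/eqP; ring.
Qed.

Lemma cabs_cis t : cabs (cis t) = 1.
Proof. by rewrite /= cos2Dsin2 sqrtr1. Qed.

(** Even powers of [i t] are real and odd ones purely imaginary, so the complex exponential series
    can be handled through the two real series of cosine and sine. *)
Lemma cis_coeff t m : ((m`!%:R^-1)%:C * (0 +i* t) ^+ m)%C =
  (cos_coeff t m +i* sin_coeff t m)%C :> R[i].
Proof.
have evenX k : ((0 +i* t) ^+ k.*2 = ((-1) ^+ k * t ^+ k.*2)%:C :> R[i])%C.
  rewrite -!muln2 mulnC !exprM -exprMn rmorphXn /=; congr (_ ^+ _).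
  by rewrite !expr2; apply/eqP; rewrite eq_complex /=; apply/andP; split; apply/eqP; ring.
rewrite -[m]odd_double_half; case: (odd m); rewrite /= ?add0n ?add1n.
  rewrite exprSr evenX /cos_coeff /sin_coeff /= odd_double /= doubleK.
  apply/eqP; rewrite eq_complex /=; apply/andP; split; apply/eqP; rewrite exprS.
    by rewrite !(mul0r, mulr0, subrr).
  by move: (_^-1) (_ ^+ _) (_ ^+ _) => a b c; ring.
rewrite evenX /cos_coeff /sin_coeff /= odd_double /= doubleK.
apply/eqP; rewrite eq_complex /=; apply/andP; split; apply/eqP.
  by rewrite mul0r subr0 mul1r mulrC.
by rewrite !(mul0r, mulr0, addr0).
Qed.

(** Finite blocks of terms from [M] to [P] are compared first; then [P] tends to infinity. *)
Lemma series_tail_le (u v : R^nat) M : cvgn (series u) -> cvgn (series v) ->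
  (forall m, `|u m| <= v m) ->
  `|limn (series u) - series u M| <= limn (series v) - series v M.
Proof.
move=> cu cv uv.
have cuM : (fun P => series u P - series u M) @ \oo --> limn (series u) - series u M.
  by apply: cvgB; [exact: cu|exact: cvg_cst].
have cvM : (fun P => series v P - series v M) @ \oo --> limn (series v) - series v M.
  by apply: cvgB; [exact: cv|exact: cvg_cst].
have cn : `|series u P - series u M| @[P --> \oo] -->
  `|limn (series u) - series u M| by exact: cvg_norm cuM.
rewrite -(cvg_lim _ cn) // -(cvg_lim _ cvM) //.
apply: ler_lim; [exact: cvgP cn|exact: cvgP cvM|].
near=> P.
have MP : (M <= P)%N by near: P; exact: nbhs_infty_ge.
rewrite !sub_series_geq //; apply: le_trans (ler_norm_sum _ _ _) _.
exact: ler_sum.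
Unshelve. all: by end_near. Qed.

Lemma le_exp_coeff t K m : `|t| <= K -> `|t| ^+ m / m`!%:R <= exp_coeff K m.
Proof.
move=> tK; rewrite /exp_coeff /= ler_pM2r ?invr_gt0 ?ltr0n ?fact_gt0 //.
by apply: lerXn2r => //; rewrite nnegrE // (le_trans _ tK).
Qed.

(** The factor 2 arises because the real and the imaginary part are each bounded by the same
    exponential tail. *)
Lemma cis_taylor t K M : `|t| <= K ->
  cabs (cis t - \sum_(m < M) (m`!%:R^-1)%:C%C * (0 +i* t)%C ^+ m) <=
  2 * (expR K - series (exp_coeff K) M).
Proof.
move=> tK.
under eq_bigr do rewrite cis_coeff.
have -> : \sum_(m < M) (cos_coeff t m +i* sin_coeff t m)%C =
    (series (cos_coeff t) M +i* series (sin_coeff t) M)%C.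
  rewrite /series /= !big_mkord; elim: M => [|M IH]; first by rewrite !big_ord0.
  by rewrite !big_ord_recr IH.
apply: le_trans (le_cabs_ReIm _) _.
have C (b : bool) (k : nat) : `|b%:R * (-1) ^+ k * (1 : R)| <= 1.
  by rewrite mulr1 normrM normrX normrN1 expr1n mulr1; case: b; rewrite ?normr1 ?normr0.
rewrite /= mulrDl mul1r lerD //.
  rewrite cos.unlock; apply: series_tail_le => [||m].
  - exact: is_cvg_series_cos_coeff.
  - exact: is_cvg_series_exp_coeff.
  apply: le_trans (le_exp_coeff m tK); rewrite -(normrX m t) -[leRHS]mul1r.
  rewrite /cos_coeff /= -mulrA normrM normrM (normrM (t ^+ m)) normfV.
  rewrite [`|m`!%:R|]normr_nat ler_wpM2r ?divr_ge0 // -normrM -[X in `|X|]mulr1.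
  exact: C.
rewrite sin.unlock; apply: series_tail_le => [||m].
- exact: is_cvg_series_sin_coeff.
- exact: is_cvg_series_exp_coeff.
apply: le_trans (le_exp_coeff m tK); rewrite -(normrX m t) -[leRHS]mul1r.
rewrite /sin_coeff /= -mulrA normrM normrM (normrM (t ^+ m)) normfV.
rewrite [`|m`!%:R|]normr_nat ler_wpM2r ?divr_ge0 // -normrM -[X in `|X|]mulr1.
exact: C.
Qed.

Lemma exp_series_le K M : 0 <= K -> series (exp_coeff K) M <= expR K.
Proof.
move=> K0; apply: nondecreasing_cvgn_le; last exact: is_cvg_series_exp_coeff.
by apply: nondecreasing_series => m _ _; exact: exp_coeff_ge0.
Qed.

(** The index is a successor so that the term of order zero can be split off the partial sum. *)
Lemma exp_series_tail_lt K eta : 0 < eta ->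
  exists M, expR K - series (exp_coeff K) M.+1 < eta.
Proof.
move=> eta0.
have /cvgrPdist_lt/(_ _ eta0)[M _ /(_ M.+1 (leqnSn M)) h] :
  series (exp_coeff K) @ \oo --> expR K by exact: is_cvg_series_exp_coeff.
by exists M; apply: le_lt_trans (ler_norm _) h.
Qed.

End TrigonometricTaylor.

(** * Trigonometric polynomials and their derivatives through coefficients *)

Section TrigonometricPolynomials.
Variables (R : realType) (d n : nat).
Implicit Types (x v : 'rV[R]_d) (a : {ffun 'I_d -> 'I_n.*2.+1})
  (c : {ffun 'I_d -> 'I_n.*2.+1} -> R[i]) (m M : nat) (j : 'I_d).

Definition trig c x : R[i] := \sum_a c a * cis (freq_phase a x).

Definition partial_coef j c a : R[i] := c a * (0 +i* ((a j)%:R - n%:R))%C.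

(** This is the iterated directional derivative [(v . grad)^m] of [trig c] at [x], written as a
    Fourier multiplier so that no iterated limit has to be handled. *)
Definition dir_derive c m v x : R[i] :=
  \sum_a c a * (0 +i* freq_phase a v)%C ^+ m * cis (freq_phase a x).

Lemma freq_phaseD a x v : freq_phase a (x + v) = freq_phase a x + freq_phase a v.
Proof. by rewrite -big_split /=; apply: eq_bigr => j _; rewrite mxE mulrDr. Qed.

Lemma freq_phaseZ a (t : R) v : freq_phase a (t *: v) = t * freq_phase a v.
Proof. by rewrite mulr_sumr; apply: eq_bigr => j _; rewrite mxE mulrCA. Qed.

Lemma freq_phase_delta a j : freq_phase a (delta_mx ord0 j : 'rV[R]_d) = (a j)%:R - n%:R.
Proof.
rewrite /freq_phase (bigD1 j) //= mxE !eqxx mulr1 big1 ?addr0 // => k kj.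
by rewrite mxE eqxx (negbTE kj) mulr0.
Qed.

Lemma freq_phase_le a v (h : R) : (forall j, `|v ord0 j| <= h) ->
  `|freq_phase a v| <= n%:R * h *+ d.
Proof.
move=> vh; apply: le_trans (ler_norm_sum _ _ _) _.
rewrite -[d in leRHS]card_ord -sumr_const; apply: ler_sum => j _.
rewrite normrM; apply: ler_pM => //.
have : (a j <= n + n)%N by rewrite addnn -ltnS.
rewrite -(ler_nat R) natrD => ajn; have : 0 <= (a j)%:R :> R by [].
by rewrite ler_norml; lra.
Qed.

Lemma cabs_trig_le c x : cabs (trig c x) <= \sum_a cabs (c a).
Proof.
apply: le_trans (le_cabs_sum _ _ _) _; apply: ler_sum => a _.
by rewrite ComplexField.Normc.normcM cabs_cis mulr1.
Qed.

Lemma dir_derive0 c v x : dir_derive c 0 v x = trig c x.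
Proof. by apply: eq_bigr => a _; rewrite expr0 mulr1. Qed.

(** One multiplier [i (k, v)] is expanded over the coordinates of [v]. Iterating this produces the
    sum over words of partial derivatives, with coefficients depending on [v] only. *)
Lemma dir_deriveS c m v x : dir_derive c m.+1 v x =
  \sum_j (v ord0 j)%:C%C * dir_derive (partial_coef j c) m v x.
Proof.
under [RHS]eq_bigr do rewrite mulr_sumr.
rewrite exchange_big /=; apply: eq_bigr => a _.
have -> : (0 +i* freq_phase a v)%C =
    \sum_j (v ord0 j)%:C%C * (0 +i* ((a j)%:R - n%:R))%C.
  apply/eqP; rewrite eq_complex !raddf_sum /=; apply/andP; split; apply/eqP.
    by rewrite big1 // => j _; ring.
  by apply: eq_bigr => j _; ring.
rewrite exprS mulr_suml mulr_sumr mulr_suml; apply: eq_bigr => j _.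
by rewrite /partial_coef; ring.
Qed.

(** The exponential remainder is applied to each harmonic separately, each having modulus one at
    [x]. *)
Lemma trig_taylor c x v (K : R) M : (forall a, `|freq_phase a v| <= K) ->
  cabs (trig c (x + v) - \sum_(m < M) (m`!%:R^-1)%:C%C * dir_derive c m v x) <=
  (\sum_a cabs (c a)) * (2 * (expR K - series (exp_coeff K) M)).
Proof.
move=> vK; under eq_bigr do rewrite mulr_sumr.
rewrite exchange_big -sumrB mulr_suml.
apply: le_trans (le_cabs_sum _ _ _) _; apply: ler_sum => a _.
have -> : c a * cis (freq_phase a (x + v)) -
    \sum_(m < M) (m`!%:R^-1)%:C%C *
      (c a * (0 +i* freq_phase a v)%C ^+ m * cis (freq_phase a x)) =
    c a * cis (freq_phase a x) * (cis (freq_phase a v) -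
     \sum_(m < M) (m`!%:R^-1)%:C%C * (0 +i* freq_phase a v)%C ^+ m).
  rewrite freq_phaseD cisD mulrBr mulr_sumr; congr (_ - _); first by ring.
  by apply: eq_bigr => m _; ring.
rewrite !ComplexField.Normc.normcM cabs_cis mulr1 ler_wpM2l ?cabs_ge0 //.
exact: cis_taylor.
Qed.

Lemma derive_line (f : 'rV[R]_d -> R) x v :
  'D_v f x = 'D_1 (fun t : R => f (t *: v + x)) 0.
Proof.
rewrite -derive1E /derive1 /derive; set u := (fun h : R => _); set w := (fun h : R => _).
suff -> : u = w by [].
by apply/funext => t; rewrite /u /w /= addr0 scale0r add0r.
Qed.

Lemma is_derive_val (f : R -> R) (t D : R) : is_derive t 1 f D -> 'D_1 f t = D.
Proof. by case. Qed.

Lemma is_derive_sum_seq (I : Type) (r : seq I) (F : I -> R -> R) (D : I -> R) (t : R) :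
  (forall i, is_derive t 1 (F i) (D i)) ->
  is_derive t 1 (fun s => \sum_(i <- r) F i s) (\sum_(i <- r) D i).
Proof.
move=> FD; elim: r => [|i r IH].
  by under eq_fun do rewrite big_nil; rewrite big_nil; exact: is_derive_cst.
under eq_fun do rewrite big_cons; rewrite big_cons.
exact: is_deriveD.
Qed.

(** This identifies the analytic derivative in the Bernstein hypothesis with the action on
    coefficients. Along the [j]-th coordinate line each phase is affine with slope [a j - n]. *)
Lemma partial_trig j c : partial j (trig c) = trig (partial_coef j c).
Proof.
apply/funext => x; rewrite /partial.
pose e : 'rV[R]_d := delta_mx ord0 j.
have phaseE a (t : R) : freq_phase a (t *: e + x) =
    t * ((a j)%:R - n%:R) + freq_phase a x.
  by rewrite freq_phaseD freq_phaseZ freq_phase_delta.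
have dphase a : is_derive (0 : R) 1 (fun t : R => t * ((a j)%:R - n%:R) + freq_phase a x)
    ((a j)%:R - n%:R).
  apply: is_derive_eq; rewrite scaler0 add0r addr0.
  by rewrite /GRing.scale /= mulr1.
have dcos a : is_derive (0 : R) 1 (fun t : R => cos (t * ((a j)%:R - n%:R) + freq_phase a x))
    (- sin (freq_phase a x) * ((a j)%:R - n%:R)).
  have := @is_derive1_comp _ cos _ _ _ _ (is_derive_cos _) (dphase a).
  by rewrite mul0r add0r.
have dsin a : is_derive (0 : R) 1 (fun t : R => sin (t * ((a j)%:R - n%:R) + freq_phase a x))
    (cos (freq_phase a x) * ((a j)%:R - n%:R)).
  have := @is_derive1_comp _ sin _ _ _ _ (is_derive_sin _) (dphase a).
  by rewrite mul0r add0r.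
rewrite !derive_line; apply/eqP; rewrite eq_complex /=; apply/andP; split; apply/eqP.
  under eq_fun do rewrite raddf_sum.
  rewrite raddf_sum /=; apply: is_derive_val; apply: is_derive_sum_seq => a.
  rewrite /partial_coef; case: (c a) => p q /=.
  under eq_fun do rewrite phaseE.
  apply: is_derive_eq; rewrite /GRing.scale /=; ring.
under eq_fun do rewrite raddf_sum.
rewrite raddf_sum /=; apply: is_derive_val; apply: is_derive_sum_seq => a.
rewrite /partial_coef; case: (c a) => p q /=.
under eq_fun do rewrite phaseE.
apply: is_derive_eq; rewrite /GRing.scale /=; ring.
Qed.

Lemma trigpoly_trig c : trigpoly n (trig c).
Proof. by exists c. Qed.

End TrigonometricPolynomials.

(** * Majorants of Taylor terms and of increments *)

(* [Q s p] reads "[s] is an admissible majorant of size at most [p]"; it is used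
   both for integrability and for the norm of [X], where [delta] absorbs the
   error in majorizing a modulus. *)
Section TaylorMajorant.
Variables (R : realType) (d n : nat).
Implicit Types (c : {ffun 'I_d -> 'I_n.*2.+1} -> R[i]) (x v : 'rV[R]_d).
Variables (P : ({ffun 'I_d -> 'I_n.*2.+1} -> R[i]) -> Prop)
  (nu : ({ffun 'I_d -> 'I_n.*2.+1} -> R[i]) -> R)
  (Q : ('rV[R]_d -> R) -> R -> Prop) (b h delta : R).
Hypotheses (h_ge0 : 0 <= h) (b_ge0 : 0 <= b) (delta_ge0 : 0 <= delta).
Hypothesis nu_ge0 : forall c, P c -> 0 <= nu c.
Hypothesis partial_P : forall c j, P c -> P (partial_coef j c).
Hypothesis partial_nu : forall c j, P c -> nu (partial_coef j c) <= b * nu c.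
Hypothesis Q0 : Q (fun=> 0) 0.
Hypothesis QD : forall s t p q, Q s p -> Q t q -> Q (fun x => s x + t x) (p + q).
Hypothesis QZ : forall s p (k : R), 0 <= k -> Q s p -> Q (fun x => k * s x) (k * p).
Hypothesis Qle : forall s p q, Q s p -> p <= q -> Q s q.
Hypothesis Q_trig : forall c, P c ->
  exists2 s, (forall x, cabs (trig c x) <= s x) & Q s (nu c + delta).

Lemma Q_sum (I : Type) (r : seq I) (s : I -> 'rV[R]_d -> R) (p : I -> R) :
  (forall i, Q (s i) (p i)) -> Q (fun x => \sum_(i <- r) s i x) (\sum_(i <- r) p i).
Proof.
move=> Qs; elim: r => [|i r IH].
  by under eq_fun do rewrite big_nil; rewrite big_nil.
by under eq_fun do rewrite big_cons; rewrite big_cons; exact: QD.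
Qed.

(** Each order costs a factor [h * b] for each of the [d] coordinates, while the additive error only
    gains [h * d]. The majorant is chosen before [v], hence serves all small displacements at
    once. *)
Lemma dir_derive_majorant m c : P c ->
  exists2 s, (forall x v, (forall j, `|v ord0 j| <= h) ->
                cabs (dir_derive c m v x) <= s x) &
    Q s ((h * d%:R * b) ^+ m * nu c + delta * (h * d%:R) ^+ m).
Proof.
elim: m c => [|m IH] c Pc.
  have [s cs Qs] := Q_trig Pc; exists s => [x v _|]; first by rewrite dir_derive0.
  by rewrite !expr0 mul1r mulr1.
have /choice[s s_spec] : forall j : 'I_d, exists s : 'rV[R]_d -> R,
    (forall x v, (forall j, `|v ord0 j| <= h) ->
      cabs (dir_derive (partial_coef j c) m v x) <= s x) /\
    Q s ((h * d%:R * b) ^+ m * nu (partial_coef j c) + delta * (h * d%:R) ^+ m).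
  by move=> j; have [s cs Qs] := IH _ (partial_P j Pc); exists s.
exists (fun x => \sum_j h * s j x) => [x v vh|].
  rewrite dir_deriveS; apply: le_trans (le_cabs_sum _ _ _) _; apply: ler_sum => j _.
  rewrite ComplexField.Normc.normcM cabs_real ler_pM ?cabs_ge0 //.
  exact: (s_spec j).1.
apply: (@Qle _ (\sum_(j < d) h * ((h * d%:R * b) ^+ m * (b * nu c) +
  delta * (h * d%:R) ^+ m))).
  apply: Q_sum => j; apply: QZ => //; apply: Qle (s_spec j).2 _.
  rewrite lerD2r ler_wpM2l ?partial_nu // exprn_ge0 // mulr_ge0 // mulr_ge0 //.
rewrite sumr_const card_ord -[leLHS]mulr_natl !exprS le_eqVlt; apply/orP; left; apply/eqP.
ring.
Qed.

(** The majorants of the Taylor terms of order at least one are summed with weights [1 / m!], which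
    yields [exp - 1]; the constant [eta] absorbs the remainder. *)
Lemma trig_increment_majorant c (eta : R) : 0 < eta -> P c ->
  exists2 s, (forall x v, (forall j, `|v ord0 j| <= h) ->
                cabs (trig c (x + v) - trig c x) <= s x + eta) &
    Q s ((expR (h * d%:R * b) - 1) * nu c + delta * expR (h * d%:R)).
Proof.
move=> eta0 Pc; pose A := \sum_a cabs (c a); pose K := n%:R * h *+ d.
have A0 : 0 <= A by apply: sumr_ge0 => a _; exact: cabs_ge0.
(* The 2 comes from [trig_taylor]; [A + 1] replaces [A], which may vanish. *)
have [M HM] : exists M, expR K - series (exp_coeff K) M.+1 < eta / (2 * (A + 1)).
  by apply: exp_series_tail_lt; rewrite divr_gt0 // mulr_gt0 // ltr_wpDl.
have /choice[s s_spec] : forall m, exists s : 'rV[R]_d -> R,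
    (forall x v, (forall j, `|v ord0 j| <= h) ->
      cabs (dir_derive c m v x) <= s x) /\
    Q s ((h * d%:R * b) ^+ m * nu c + delta * (h * d%:R) ^+ m).
  by move=> m; have [s cs Qs] := dir_derive_majorant m Pc; exists s.
exists (fun x => \sum_(1 <= m < M.+1) m`!%:R^-1 * s m x) => [x v vh|].
  have := @trig_taylor _ _ _ c x v K M.+1 (fun a => freq_phase_le a vh).
  rewrite big_ord_recl /= fact0 invr1 mul1r dir_derive0 => taylor.
  set S := \sum_(i < M) _ in taylor.
  have -> : trig c (x + v) - trig c x = S + (trig c (x + v) - (trig c x + S)) by ring.
  apply: le_trans (le_cabsD _ _) _; apply: lerD.
    rewrite big_add1 /= big_mkord; apply: le_trans (le_cabs_sum _ _ _) _.
    apply: ler_sum => m _; rewrite ComplexField.Normc.normcM cabs_real.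
    by rewrite ger0_norm ?invr_ge0 // ler_wpM2l ?invr_ge0 //; exact: (s_spec _).1.
  apply: le_trans taylor _; rewrite -/A.
  have : (A + 1) * (2 * (expR K - series (exp_coeff K) M.+1)) <= eta.
    rewrite mulrCA mulrA [leLHS]mulrC -ler_pdivlMr; first exact: ltW.
    by rewrite mulr_gt0 // ltr_wpDl.
  apply: le_trans; rewrite ler_wpM2r ?lerDl //.
  rewrite mulr_ge0 // subr_ge0 exp_series_le // mulrn_wge0 // mulr_ge0 //.
(* The sum starts at order one, hence the [- 1]. *)
have expE (z : R) : 0 <= z -> \sum_(1 <= m < M.+1) m`!%:R^-1 * z ^+ m <= expR z - 1.
  move=> z0; rewrite lerBrDl; apply: le_trans (exp_series_le M.+1 z0).
  rewrite /series /= [leRHS]big_nat_recl // /exp_coeff /= expr0 divr1 lerD2l.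
  by rewrite big_add1 /=; apply: ler_sum => m _; rewrite mulrC.
apply: (@Qle _ (\sum_(1 <= m < M.+1) m`!%:R^-1 *
    ((h * d%:R * b) ^+ m * nu c + delta * (h * d%:R) ^+ m))).
  by apply: Q_sum => m; apply: QZ (s_spec m).2; rewrite invr_ge0.
have -> : \sum_(1 <= m < M.+1) m`!%:R^-1 *
      ((h * d%:R * b) ^+ m * nu c + delta * (h * d%:R) ^+ m) =
    (\sum_(1 <= m < M.+1) m`!%:R^-1 * (h * d%:R * b) ^+ m) * nu c +
    delta * (\sum_(1 <= m < M.+1) m`!%:R^-1 * (h * d%:R) ^+ m).
  rewrite mulr_suml mulr_sumr -big_split /=; apply: eq_bigr => m _; ring.
apply: lerD; first by rewrite ler_wpM2r ?nu_ge0 // expE // !mulr_ge0.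
by rewrite ler_wpM2l // (le_trans (expE _ _)) ?mulr_ge0 // gerDl oppr_le0.
Qed.

End TaylorMajorant.

(** * Borel measurability of the torus and of the cubes *)

Section BorelSets.
Variables (R : realType) (d : nat).

Lemma closed_borel (A : set 'rV[R]_d) : closed A -> measurable (A : set (borelRd R d)).
Proof.
move=> cA; rewrite -[A]setCK; apply: measurableC.
by apply: sub_sigma_algebra; exact: closed_openC.
Qed.

Lemma measurable_coord_ge (a : R) (j : 'I_d) :
  measurable ([set x : 'rV[R]_d | a <= x ord0 j] : set (borelRd R d)).
Proof.
apply: closed_borel.
apply: (@preimage_closed _ _ (fun x : 'rV[R]_d => x ord0 j) [set y | a <= y]).
  by move=> x _; exact: coord_continuous.
exact: closed_ge.
Qed.

Lemma measurable_coord_le (a : R) (j : 'I_d) :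
  measurable ([set x : 'rV[R]_d | x ord0 j <= a] : set (borelRd R d)).
Proof.
apply: closed_borel.
apply: (@preimage_closed _ _ (fun x : 'rV[R]_d => x ord0 j) [set y | y <= a]).
  by move=> x _; exact: coord_continuous.
exact: closed_le.
Qed.

Lemma measurable_forall_coord (A : 'I_d -> set (borelRd R d)) :
  (forall j, measurable (A j)) -> measurable [set x | forall j, A j x].
Proof.
move=> mA; have -> : [set x | forall j, A j x] = \bigcap_(j in setT) A j.
  by apply/seteqP; split => x Ax j //; exact: Ax.
by apply: fin_bigcap_measurable.
Qed.

Lemma measurable_torus : measurable (@torus R d).
Proof.
apply: (@measurable_forall_coord (fun j => [set x | 0 <= x ord0 j < 2 * pi])) => j.
have := measurableD (measurable_coord_ge 0 j) (measurable_coord_ge (2 * pi) j).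
congr measurable; apply/seteqP; split => x /=.
  by case=> -> /negP; rewrite -ltNge.
by case/andP => -> /lt_geF ->.
Qed.

Lemma measurable_cube N (k : {ffun 'I_d -> 'I_N}) : measurable (@cube R d N k).
Proof.
apply: (@measurable_forall_coord (fun j => [set x | _ <= x ord0 j <= _])) => j.
have := measurableI _ _ (measurable_coord_ge (2 * pi * (k j)%:R / N%:R) j)
  (measurable_coord_le (2 * pi * (k j).+1%:R / N%:R) j).
by congr measurable; apply/seteqP; split => x /= => [[-> ->]|/andP[]].
Qed.

End BorelSets.

(** * Real functions in the lattice and bounds on their norms *)

Section Lattice.
Variables (R : realType) (d : nat) (mu : {measure set (borelRd R d) -> \bar R}).
Variable X : banach_lattice mu.
Implicit Types (f : borelRd R d -> R[i]) (s t : borelRd R d -> R).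

Definition rlift s : borelRd R d -> R[i] := fun x => (s x)%:C%C.

(** This is the instance of [Q] used for the norm of [X]. *)
Definition bounded_in s (p : R) := carrier X (rlift s) /\ latnorm X (rlift s) <= p.

Lemma latnorm0 : latnorm X (fun=> 0) = 0.
Proof. by apply/latnorm_eq0; [exact: carrier0|exact: aeW]. Qed.

(** Nonnegativity is not an axiom of [banach_lattice]; it follows from monotonicity by comparison
    with zero. *)
Lemma latnorm_ge0 f : carrier X f -> 0 <= latnorm X f.
Proof.
move=> Xf; rewrite -latnorm0; apply: latnorm_le => //; first exact: carrier0.
by apply: aeW => x; rewrite cabs_real normr0 cabs_ge0.
Qed.

Lemma bounded_in0 : bounded_in (fun=> 0) 0.
Proof.
by split; [exact: carrier0|rewrite (_ : rlift _ = fun=> 0) ?latnorm0].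
Qed.

Lemma bounded_inD s t p q : bounded_in s p -> bounded_in t q ->
  bounded_in (fun x => s x + t x) (p + q).
Proof.
move=> [Xs sp] [Xt tq].
rewrite /bounded_in (_ : rlift _ = (fun x => rlift s x + rlift t x)); last first.
  by apply/funext => x; rewrite /rlift rmorphD.
split; first exact: carrierD.
by apply: le_trans (latnormD Xs Xt) _; exact: lerD.
Qed.

Lemma bounded_inZ s p (k : R) : 0 <= k -> bounded_in s p ->
  bounded_in (fun x => k * s x) (k * p).
Proof.
move=> k0 [Xs sp].
rewrite /bounded_in (_ : rlift _ = (fun x => k%:C%C * rlift s x)); last first.
  by apply/funext => x; rewrite /rlift rmorphM.
split; first exact: carrierZ.
by rewrite latnormZ // cabs_real ger0_norm // ler_wpM2l.
Qed.

Lemma bounded_in_le s p q : bounded_in s p -> p <= q -> bounded_in s q.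
Proof. by move=> [Xs sp] pq; split => //; exact: le_trans sp pq. Qed.

Lemma bounded_in_latnorm s : carrier X (rlift s) -> bounded_in s (latnorm X (rlift s)).
Proof. by []. Qed.

Lemma carrier_sum (I : Type) (r : seq I) (s : I -> borelRd R d -> R) :
  (forall i, carrier X (rlift (s i))) -> carrier X (rlift (fun x => \sum_(i <- r) s i x)).
Proof.
by move=> Xs; apply: (proj1 (Q_sum bounded_in0 bounded_inD r
  (fun i => bounded_in_latnorm (Xs i)))).
Qed.

(** * Simple functions over a finite measure *)

Section FiniteMeasure.
Hypothesis mu_fin : (mu setT < +oo)%E.

Lemma carrier_scaled_indic (A : set (borelRd R d)) (k : R) : measurable A ->
  carrier X (rlift (fun x => k * \1_A x)).
Proof.
move=> mA.
have -> : rlift (fun x => k * \1_A x) = (fun x => k%:C%C * (\1_A x)%:C%C).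
  by apply/funext => x; rewrite /rlift rmorphM.
apply: carrierZ; apply: carrier_indic => //.
by apply: le_lt_trans mu_fin; apply: le_measure; rewrite ?inE.
Qed.

Lemma carrier_cst (k : R) : carrier X (rlift (fun=> k)).
Proof.
have := carrier_scaled_indic k measurableT.
by rewrite (_ : rlift _ = rlift (fun=> k)) //; apply/funext => x; rewrite /rlift indicT mulr1.
Qed.

(* Since [X] is not assumed to contain [|f|], the modulus is replaced by a
   simple function lying above it, which belongs to [X] as [mu] is finite. *)
Lemma modulus_majorant f (C delta : R) : carrier X f -> (forall x, cabs (f x) <= C) ->
  0 < delta ->
  exists2 s, (forall x, cabs (f x) <= s x) & bounded_in s (latnorm X f + delta).
Proof.
move=> Xf fC delta0; pose L := latnorm X (rlift (fun=> 1)).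
have L0 : 0 <= L by apply: latnorm_ge0; exact: carrier_cst.
(* The mesh is such that the constant [tau] has norm at most [delta]; [L + 1] avoids division by
   zero. *)
pose tau := delta / (L + 1).
have tau0 : 0 < tau by rewrite divr_gt0 // ltr_wpDl.
have tauL : tau * L <= delta.
  by rewrite /tau mulrAC ler_pdivrMr ?ltr_wpDl // ler_wpM2l ?lerDl // ltW.
pose A (j : nat) : set (borelRd R d) := [set x | j.+1%:R * tau <= cabs (f x)].
have mA j : measurable (A j).
  have /measurable_int := carrier_integrable Xf.
  move=> /(measurable_realfun.emeasurable_fun_c_infty measurableT)/(_ (j.+1%:R * tau)%:E).
  by rewrite setTI; under eq_set do rewrite lee_fin.
(* [S J] is [|f|] rounded down to a multiple of [tau] and truncated at [J * tau]. The last
   alternative below says that either the rounding error is under [tau] or the truncation level is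
   reached. *)
pose S J x : R := \sum_(j < J) tau * \1_(A j) x.
have S_spec J x : [/\ S J x <= J%:R * tau, S J x <= cabs (f x) &
    cabs (f x) < S J x + tau \/ S J x = J%:R * tau].
  elim: J => [|J [IH1 IH2 IH3]].
    by rewrite /S big_ord0 mul0r; split => //; [exact: cabs_ge0|right].
  have -> : S J.+1 x = S J x + tau * \1_(A J) x by rewrite /S big_ord_recr.
  rewrite indicE; have [/set_mem/= Ax|/negP Ax] := boolP (x \in A J).
    rewrite mulr1; case: IH3 => [|->].
      move=> lt_f; move: (le_lt_trans Ax lt_f).
      by rewrite -natr1 mulrDl mul1r ltrD2r ltNge IH1.
    by move: Ax; rewrite /A /= -natr1 mulrDl mul1r => Ax; split => //; right.
  have {}Ax : cabs (f x) < J.+1%:R * tau.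
    by rewrite ltNge; apply/negP => le_f; apply: Ax; exact: mem_set.
  rewrite mulr0 addr0; split => //.
    by rewrite (le_trans IH1) // ler_pM2r // ler_nat.
  by left; case: IH3 => // ->; move: Ax; rewrite -natr1 mulrDl mul1r.
pose J := Num.Def.trunc (`|C| / tau); pose J1 := J.+1.
have CJ : C < J1%:R * tau.
  rewrite -ltr_pdivrMr //; apply: le_lt_trans (_ : C / tau <= `|C| / tau) _.
    by rewrite ler_pM2r ?invr_gt0 // ler_norm.
  by have /andP[] := truncn_itv (divr_ge0 (normr_ge0 C) (ltW tau0)).
have XS : carrier X (rlift (S J1)).
  by apply: carrier_sum => j; exact: carrier_scaled_indic.
(* Adding [tau] lifts the rounded function above [|f|]; where the truncation level is reached, it
   already exceeds [C]. *)
exists (fun x => S J1 x + tau * 1) => [x|].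
  have [_ _ [/ltW|SJ]] := S_spec J1 x; rewrite mulr1 //.
  by rewrite SJ (le_trans (fC x)) // ltW // (lt_le_trans CJ) // lerDl ltW.
apply: (@bounded_in_le _ (latnorm X f + tau * L)); last by rewrite lerD2l.
apply: bounded_inD; last first.
  by apply: bounded_inZ; [exact: ltW|apply: bounded_in_latnorm; exact: carrier_cst].
split => //; apply: latnorm_le => //; apply: aeW => x.
rewrite cabs_real ger0_norm; first by case: (S_spec J1 x).
by apply: sumr_ge0 => j _; rewrite mulr_ge0 // ltW.
Qed.

End FiniteMeasure.
End Lattice.

(* Every derivative of [T] lies in [X], hence is integrable, and by Taylor's
   formula their moduli together bound the constant [|T y|] from below on the
   torus. *)
Lemma trig_carrier_finite (R : realType) (d n : nat)
  (mu : {measure set (borelRd R d) -> \bar R}) (X : banach_lattice mu)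
  (c : {ffun 'I_d -> 'I_n.*2.+1} -> R[i]) (y : 'rV[R]_d) :
  mu (~` @torus R d) = 0%E ->
  (forall (c' : {ffun 'I_d -> 'I_n.*2.+1} -> R[i]) j, carrier X (trig c') ->
    carrier X (trig (partial_coef j c'))) ->
  carrier X (trig c) -> trig c y != 0 -> (mu setT < +oo)%E.
Proof.
move=> mu_torus Xpartial Xc cy0.
have cy_gt0 : 0 < cabs (trig c y).
  rewrite lt_neqAle cabs_ge0 andbT; apply/eqP => /esym/ComplexField.Normc.eq0_normc.
  exact/eqP.
(* Half of [|T y|] pays for the Taylor remainder, the other half remains as the lower bound. *)
pose eta := cabs (trig c y) / 2.
have eta0 : 0 < eta by rewrite divr_gt0.
(* [L] bounds the coordinates of [y - x] for every [x] in the torus. *)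
pose L := 2 * pi + \sum_j `|y ord0 j|.
have L0 : 0 <= L by rewrite addr_ge0 ?mulr_ge0 ?pi_ge0 // sumr_ge0.
(* Only integrability matters here, so the size [p] is ignored and [nu], [b], [delta] are all taken
   to be zero. *)
pose Q (s : 'rV[R]_d -> R) (p : R) :=
  mu.-integrable setT (fun x : borelRd R d => (s x)%:E).
have [s s_inc s_int] : exists2 s, (forall x v : 'rV[R]_d, (forall j, `|v ord0 j| <= L) ->
      cabs (trig c (x + v) - trig c x) <= s x + eta) &
    Q s ((expR (L * d%:R * 0) - 1) * 0 + 0 * expR (L * d%:R)).
  apply: (@trig_increment_majorant R d n (fun c' => carrier X (trig c'))
      (fun=> 0) Q 0 L 0) => //.
  - exact: integrable0.
  - by move=> s t p q Qs Qt; exact: (integrableD measurableT Qs Qt).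
  - by move=> s p k k0 Qs; exact: (integrableZl measurableT k Qs).
  - by move=> c' Xc'; exists (fun x => cabs (trig c' x)) => //; exact: carrier_integrable Xc'.
pose g (x : borelRd R d) := ((cabs (trig c x))%:E + (s x)%:E)%E.
have g_int : mu.-integrable setT g.
  exact: (integrableD measurableT (carrier_integrable Xc) s_int).
have mtorus := @measurable_torus R d.
have : mu.-integrable (@torus R d) (cst eta%:E).
  apply: (le_integrable mtorus) (integrableS measurableT mtorus (@subsetT _ _) g_int) => //.
  move=> x /= xt; rewrite lee_fin gtr0_norm //; apply: le_trans (ler_norm _).
  have xyL j : `|(y - x : 'rV[R]_d) ord0 j| <= L.
    rewrite !mxE; apply: le_trans (ler_normB _ _) _; rewrite addrC.
    have /andP[x0 x1] := xt j; apply: lerD; first by rewrite ger0_norm // ltW.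
    by rewrite (bigD1 j) //= lerDl sumr_ge0.
  have := s_inc x _ xyL; rewrite [x + _]addrC subrK => s_xy.
  have := le_cabsD (trig c y - trig c x) (trig c x); rewrite subrK => tri.
  rewrite -(lerD2r eta) [leLHS](_ : _ = cabs (trig c y)); last first.
    by rewrite /eta; field.
  by apply: le_trans tri _; rewrite [leLHS]addrC -addrA lerD2l.
case/integrableP => _; rewrite (eq_integral (cst eta%:E)); last first.
  by move=> x _ /=; rewrite gtr0_norm.
rewrite integral_cst // => fin.
(* If the torus had infinite measure, the integral of the positive constant [eta] would be
   infinite. *)
have torus_fin : (mu (@torus R d) < +oo)%E.
  move: fin; case: (mu (@torus R d)) (measure_ge0 mu (@torus R d)) => [r _ _|_|//].
    by rewrite ltry.
  by rewrite gt0_muley ?lte_fin.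
rewrite -(setvU (@torus R d)) measureU ?setICl //; last exact: measurableC.
by rewrite [X in (X + _)%E]mu_torus add0e.
Qed.

(** * Covering, diameter and overlap of the cubes *)

Section Cubes.
Variables (R : realType) (d N : nat).
Hypothesis N_gt0 : (0 < N)%N.

Let N0 : 0 < N%:R :> R. Proof. by rewrite ltr0n. Qed.

Let pi2 : 0 < 2 * pi :> R. Proof. by rewrite mulr_gt0 // pi_gt0. Qed.

(** The index is the integer part of [x_j N / (2 pi)]; it is below [N] because the torus is
    half-open. *)
Lemma torus_cube (x : 'rV[R]_d) : torus x -> exists k : {ffun 'I_d -> 'I_N}, cube k x.
Proof.
move=> xt; pose t j := x ord0 j * N%:R / (2 * pi).
have t0 j : 0 <= t j.
  by have /andP[x0 _] := xt j; rewrite divr_ge0 ?mulr_ge0 ?pi_ge0.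
have t_lt j : (Num.Def.trunc (t j) < N)%N.
  rewrite -(ltr_nat R); have /andP[le_t _] := truncn_itv (t0 j).
  apply: le_lt_trans le_t _; rewrite ltr_pdivrMr // mulrC ltr_pM2l //.
  by have /andP[] := xt j.
exists [ffun j => Ordinal (t_lt j)] => j; rewrite ffunE /=.
have /andP[le_t /ltW t_le] := truncn_itv (t0 j).
rewrite ler_pdivrMr // ler_pdivlMr //; apply/andP; split.
  by rewrite mulrC -ler_pdivlMr.
by rewrite [leRHS]mulrC -ler_pdivrMr.
Qed.

Lemma cube_dist (k : {ffun 'I_d -> 'I_N}) (x y : 'rV[R]_d) (j : 'I_d) :
  cube k x -> cube k y -> `|(y - x) ord0 j| <= 2 * pi / N%:R.
Proof.
move=> /(_ j)/andP[x0 x1] /(_ j)/andP[y0 y1]; rewrite !mxE ler_norml.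
have e : 2 * pi * (k j).+1%:R / N%:R = 2 * pi * (k j)%:R / N%:R + 2 * pi / N%:R :> R.
  by rewrite -natr1; ring.
by move: x1 y1; rewrite e => x1 y1; lra.
Qed.

(* Two cubes with a common point have coordinates differing by at most one, so
   they are distinguished by the parities of their coordinates. *)
Lemma cube_multiplicity (x : 'rV[R]_d) :
  (#|[pred k : {ffun 'I_d -> 'I_N} | x \in cube k]| <= 2 ^ d)%N.
Proof.
have -> : (2 ^ d)%N = #|{: {ffun 'I_d -> bool}}| by rewrite card_ffun card_bool card_ord.
apply: (@leq_card_in _ _ (fun k : {ffun 'I_d -> 'I_N} => [ffun j => odd (k j)])).
move=> k l; rewrite !inE => kx lx /ffunP kl.
apply/ffunP => j; apply/val_inj => /=.
have := kl j; rewrite !ffunE.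
have close (a b : {ffun 'I_d -> 'I_N}) : cube a x -> cube b x -> (a j <= (b j).+1)%N.
  move=> /(_ j)/andP[a0 _] /(_ j)/andP[_ b1]; rewrite -(ler_nat R).
  by have := le_trans a0 b1; rewrite ler_pM2r ?invr_gt0 // ler_pM2l.
have := close k l kx lx; have := close l k lx kx.
rewrite leq_eqVlt ltnS => /orP[/eqP -> _ /=|le_lk]; first by case: (odd _).
rewrite leq_eqVlt ltnS => /orP[/eqP -> /=|le_kl _]; first by case: (odd _).
by apply/eqP; rewrite eqn_leq le_kl.
Qed.

End Cubes.

(** * Comparison of the polynomial with its sampled function *)

Section Sampling.
Variables (R : realType) (d n N : nat) (mu : {measure set (borelRd R d) -> \bar R}).
Variables (X : banach_lattice mu) (b : R).
Variables (c : {ffun 'I_d -> 'I_n.*2.+1} -> R[i]) (p : {ffun 'I_d -> 'I_N} -> 'rV[R]_d).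
Hypothesis mu_torus : mu (~` @torus R d) = 0%E.
Hypothesis mu_fin : (mu setT < +oo)%E.
Hypothesis b_ge0 : 0 <= b.
Hypothesis bernstein : forall (c' : {ffun 'I_d -> 'I_n.*2.+1} -> R[i]) j,
  carrier X (trig c') -> carrier X (trig (partial_coef j c')) /\
  latnorm X (trig (partial_coef j c')) <= b * latnorm X (trig c').
Hypothesis N_gt0 : (0 < N)%N.
Hypothesis Xc : carrier X (trig c).
Hypothesis cube_p : forall k, cube k (p k).

Let T := trig c.
Let samples (x : borelRd R d) : R := \sum_k cabs (T (p k)) * \1_(cube k) x.
(** This is the relative size of the increment over one cube, of side [2 pi / N]. *)
Let rho := expR (2 * pi / N%:R * d%:R * b) - 1.

Lemma sampledE : sampled T p = rlift samples.
Proof. by apply/funext => x; rewrite /sampled /rlift raddf_sum. Qed.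

Lemma carrier_sampled : carrier X (sampled T p).
Proof.
rewrite sampledE; apply: carrier_sum => k; apply: carrier_scaled_indic => //.
exact: measurable_cube.
Qed.

Lemma samples_ge x k : cube k x -> cabs (T (p k)) <= samples x.
Proof.
move=> kx; rewrite /samples (bigD1 k) //= indicE mem_set // mulr1 lerDl.
by apply: sumr_ge0 => l _; rewrite mulr_ge0 // cabs_ge0.
Qed.

Lemma samples_le x (u : R) : 0 <= u ->
  (forall k, cube k x -> cabs (T (p k)) <= u) -> samples x <= (2 ^ d)%:R * u.
Proof.
move=> u0 le_u; rewrite /samples (bigID (fun k => x \in cube k)) /= addrC.
rewrite big1 ?add0r; last by move=> k /negbTE kx; rewrite indicE kx mulr0.
apply: (@le_trans _ _ (\sum_(k : {ffun 'I_d -> 'I_N} | x \in cube k) u)).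
  by apply: ler_sum => k kx; rewrite indicE kx mulr1 le_u //; exact: set_mem.
rewrite sumr_const -[leLHS]mulr_natl ler_wpM2r // ler_nat.
exact: cube_multiplicity.
Qed.

(** On a cube, [|T x|] and the sample value differ by at most the increment majorant. The first
    bound needs one cube around almost every point, the second the bound [2 ^ d] on the overlap. *)
Lemma sampling_inequalities (e : R) : 0 < e ->
  latnorm X T <= latnorm X (sampled T p) + (rho * latnorm X T + e) /\
  latnorm X (sampled T p) <= (2 ^ d)%:R * (latnorm X T + (rho * latnorm X T + e)).
Proof.
move=> e0; pose h : R := 2 * pi / N%:R.
have h0 : 0 <= h by rewrite divr_ge0 // mulr_ge0 // pi_ge0.
pose L := latnorm X (rlift (fun=> 1)).
have L0 : 0 <= L by apply: latnorm_ge0; exact: carrier_cst.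
(* The three summands count the errors in units of [delta]: majorizing [|T|], majorizing the
   derivatives, and the norm of the constant remainder [delta]. *)
pose w := 1 + expR (h * d%:R) + L.
have w0 : 0 < w by rewrite ltr_wpDr // addr_gt0 // expR_gt0.
pose delta := e / w.
have delta0 : 0 < delta by rewrite divr_gt0.
have Tbound (c' : {ffun 'I_d -> 'I_n.*2.+1} -> R[i]) : carrier X (trig c') ->
    exists2 s, (forall x, cabs (trig c' x) <= s x) &
      bounded_in X s (latnorm X (trig c') + delta).
  by move=> Xc'; apply: modulus_majorant (cabs_trig_le c') delta0.
have [s s_inc s_bound] : exists2 s, (forall x v : 'rV[R]_d, (forall j, `|v ord0 j| <= h) ->
      cabs (trig c (x + v) - trig c x) <= s x + delta) &
    bounded_in X s (rho * latnorm X T + delta * expR (h * d%:R)).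
  apply: (@trig_increment_majorant R d n (fun c' => carrier X (trig c'))
      (fun c' => latnorm X (trig c')) (bounded_in X) b h delta) => //.
  - exact: ltW.
  - by move=> c'; exact: latnorm_ge0.
  - by move=> c' j Xc'; have [] := bernstein j Xc'.
  - by move=> c' j Xc'; have [] := bernstein j Xc'.
  - exact: bounded_in0.
  - exact: bounded_inD.
  - by move=> *; exact: bounded_inZ.
  - by move=> *; apply: bounded_in_le; eassumption.
have [t t_ge t_bound] := Tbound c Xc.
have one_bound : bounded_in X (fun=> delta * 1) (delta * L).
  by apply: bounded_inZ; [exact: ltW|apply: bounded_in_latnorm; exact: carrier_cst].
have inc (x : 'rV[R]_d) k : cube k x -> cabs (T (p k) - T x) <= s x + delta * 1.
  move=> kx; have := s_inc x (p k - x) (fun j => cube_dist j kx (cube_p k)).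
  by rewrite [x + _]addrC subrK mulr1.
have e_split : delta + delta * expR (h * d%:R) + delta * L = e.
  by rewrite -{1}[delta]mulr1 -!mulrDr /delta divfK // gt_eqF.
have samples0 x : 0 <= samples x.
  by apply: sumr_ge0 => l _; rewrite mulr_ge0 // cabs_ge0.
have Xsamples : bounded_in X samples (latnorm X (sampled T p)).
  by rewrite sampledE; apply: bounded_in_latnorm; rewrite -sampledE; exact: carrier_sampled.
split.
  have [Xm m_le] := bounded_inD Xsamples (bounded_inD s_bound one_bound).
  apply: (@le_trans _ _ (latnorm X (rlift (fun x => samples x + (s x + delta * 1))))).
    (* The pointwise bound is proved only on the torus, which the cubes cover; its complement is
       null. *)
    apply: latnorm_le => //; exists (~` @torus R d); split => //.
      by apply: measurableC; exact: measurable_torus.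
    move=> x /= nle xt; apply: nle; have [k kx] := torus_cube N_gt0 xt.
    rewrite [leRHS]cabs_real; apply: le_trans (ler_norm _).
    apply: le_trans (lerD (samples_ge kx) (inc x k kx)).
    rewrite -[cabs (T (p k) - T x)]cabsN; apply: le_trans (le_cabsD _ _).
    by rewrite opprB addrC subrK.
  apply: le_trans m_le _; rewrite lerD2l -addrA lerD2l -e_split -addrA lerDr //.
  exact: ltW.
have [Xm m_le] := bounded_inZ (ler0n R (2 ^ d))
  (bounded_inD t_bound (bounded_inD s_bound one_bound)).
rewrite [in leLHS]sampledE; apply: le_trans (le_trans m_le _).
  apply: latnorm_le => //; first by case: Xsamples.
  apply: aeW => x; rewrite [leLHS]cabs_real [leRHS]cabs_real (ger0_norm (samples0 x)).
  apply: le_trans (ler_norm _); have [ [k kx]|nok] := pselect (exists k : {ffun 'I_d -> 'I_N}, cube k x).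
    have le_u l : cube l x -> cabs (T (p l)) <= t x + (s x + delta * 1).
      move=> lx; have := le_cabsD (T x) (T (p l) - T x); rewrite addrC subrK.
      by move/le_trans; apply; apply: lerD; [exact: t_ge|exact: inc].
    by apply: samples_le => //; apply: le_trans (le_u k kx); exact: cabs_ge0.
  (* Outside all cubes the samples vanish, and the majorant is nonnegative there, as the zero
     displacement in [s_inc] shows. *)
  rewrite /samples big1 => [|k _].
    have s_ge x' : 0 <= s x' + delta.
      apply: le_trans (s_inc x' 0 _); first exact: cabs_ge0.
      by move=> j; rewrite mxE normr0.
    by rewrite mulr_ge0 // mulr1 addr_ge0 //; apply: le_trans (t_ge x); exact: cabs_ge0.
  by rewrite indicE memNset ?mulr0 // => kx; apply: nok; exists k.
rewrite ler_wpM2l // -e_split le_eqVlt; apply/orP; left; apply/eqP; ring.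
Qed.

End Sampling.

Theorem theorem4p7 (R : realType) (d : nat)
  (mu : {sigma_finite_measure set (borelRd R d) -> \bar R})
  (mu_torus : mu (~` @torus R d) = 0%E)
  (X : banach_lattice mu) (eps : R) (eps_gt0 : 0 < eps)
  (B : R) (B_gt0 : 0 < B)
  (bernstein : forall (n : nat) (T : 'rV[R]_d -> R[i]) (i : 'I_d),
    trigpoly n T -> carrier X T ->
    carrier X (partial i T) /\
    latnorm X (partial i T) <= B * n%:R * latnorm X T) :
  exists c1 c2 : R, [/\ 0 < c1, 0 < c2 &
    forall (n N : nat) (T : 'rV[R]_d -> R[i])
           (p : {ffun 'I_d -> 'I_N} -> 'rV[R]_d),
      (0 < N)%N ->
      (2 * pi * d%:R * B / ln 2 + eps) * n%:R <= N%:R ->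
      trigpoly n T -> carrier X T ->
      (forall k, cube k (p k)) ->
      [/\ carrier X (sampled T p),
          c1 * latnorm X (sampled T p) <= latnorm X T &
          latnorm X T <= c2 * latnorm X (sampled T p)]].
Proof.
pose A : R := 2 * pi * d%:R * B; pose D := A / ln 2 + eps.
have ln2 : 0 < ln 2 :> R by rewrite ln_gt0 // ltr1n.
have A0 : 0 <= A by rewrite !mulr_ge0 ?pi_ge0 // ltW.
have D0 : 0 < D by rewrite ltr_wpDl // divr_ge0 // ltW.
(* [r] is a lower bound for [1 - rho] that is independent of [n] and [N]. It is positive because
   [D * ln 2 = A + eps * ln 2] exceeds [A]; this is where [eps] enters. *)
pose r := 2 - expR (A / D).
have r0 : 0 < r.
  rewrite subr_gt0 -[ltRHS]lnK ?posrE // ltr_expR ltr_pdivrMr //.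
  by rewrite mulrDr mulrCA divff ?gt_eqF // mulr1 ltrDl mulr_gt0.
(* [2 ^ d] comes from the overlap of the cubes and the 2 from [1 + rho <= 2]. *)
pose c1 : R := ((2 ^ d)%:R * 2)^-1.
have c1_gt0 : 0 < c1 by rewrite invr_gt0 mulr_gt0 // ltr0n expn_gt0.
exists c1, r^-1; split; rewrite ?invr_gt0 // => n N T p N0 DN.
move=> [c Tc] XT pk.
have {Tc}TE : T = trig c by apply/funext.
subst T.
have bern (c' : {ffun 'I_d -> 'I_n.*2.+1} -> R[i]) j : carrier X (trig c') ->
    carrier X (trig (partial_coef j c')) /\
    latnorm X (trig (partial_coef j c')) <= B * n%:R * latnorm X (trig c').
  by move=> Xc'; rewrite -partial_trig; apply: bernstein; first exact: trigpoly_trig.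
(* Finiteness of [mu] is only available when [T] is not identically zero; otherwise the sampled
   function is zero as well. *)
have [cN0|c0] := pselect (exists y, trig c y != 0); last first.
  have c_eq0 y : trig c y = 0.
    by apply: contrapT => /eqP cy; apply: c0; exists y.
  have -> : sampled (trig c) p = fun=> 0.
    apply/funext => x; rewrite /sampled big1 // => k _.
    by rewrite c_eq0 ComplexField.Normc.normc0 mul0r.
  have -> : trig c = fun=> 0 by apply/funext.
  by rewrite latnorm0 !mulr0; split => //; exact: carrier0.
have mu_fin : (mu setT < +oo)%E.
  by case: cN0 => y; apply: trig_carrier_finite XT => // c' j Xc'; have [] := bern c' j Xc'.
have bn0 : 0 <= B * n%:R by rewrite mulr_ge0 // ltW.
have ineq := sampling_inequalities mu_torus mu_fin bn0 bern N0 XT pk.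
have XS := @carrier_sampled R d n N mu X c p mu_fin.
have T0 := latnorm_ge0 XT.
(* The exponent equals [A * (n / N)], and the hypothesis on [N] gives [n / N <= 1 / D]. *)
have rhoT : (expR (2 * pi / N%:R * d%:R * (B * n%:R)) - 1) * latnorm X (trig c) <=
    (1 - r) * latnorm X (trig c).
  have -> : 1 - r = expR (A / D) - 1 by rewrite /r; ring.
  rewrite ler_wpM2r // lerD2r ler_expR.
  have -> : 2 * pi / N%:R * d%:R * (B * n%:R) = A * (n%:R / N%:R) by rewrite /A; ring.
  by rewrite ler_wpM2l // ler_pdivrMr ?ltr0n // ler_pdivlMl.
split; first exact: XS.
  rewrite mulrC ler_pdivrMr ?mulr_gt0 ?ltr0n ?expn_gt0 //.
  apply/ler_addgt0Pr => e e0.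
  have q0 : 0 < (2 ^ d)%:R :> R by rewrite ltr0n expn_gt0.
  have /ineq[_ le_S] : 0 < e / (2 ^ d)%:R by rewrite divr_gt0.
  apply: le_trans le_S _.
  rewrite addrA mulrDr [_ * (e / _)]mulrC divfK ?gt_eqF // lerD2r [leRHS]mulrCA.
  rewrite ler_wpM2l // [leRHS]mulr_natr mulr2n lerD2l.
  apply: le_trans rhoT _; rewrite -[leRHS]mul1r ler_wpM2r // gerDl oppr_le0 ltW //.
(* The term [(1 - r) * |T|_X] is moved to the left, leaving [r * |T|_X]. *)
rewrite mulrC ler_pdivlMr //; apply/ler_addgt0Pr => e /ineq[le_T _].
have -> : latnorm X (trig c) * r = latnorm X (trig c) - (1 - r) * latnorm X (trig c) by ring.
by rewrite lerBlDr; apply: le_trans le_T _; rewrite -[leRHS]addrA lerD2l [leLHS]addrC lerD2l.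
Qed.
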